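(* Consider the triangle of groups (Corson diagram based on $I=\{1,2,3\}$) given by $G_\emptyset=\{1\}$, $G_{\{1\}}=\langle a\,:\,-\rangle$, $G_{\{2\}}=\langle b\,:\,-\rangle$, $G_{\{3\}}=\langle c\,:\,-\rangle$ (infinite cyclic groups), $G_{\{1,2\}}=\langle a,b\,:\,b^{-1}ab=a^2\rangle$, $G_{\{1,3\}}=\langle a,c\,:\,c^{-1}ac=a^2\rangle$, $G_{\{2,3\}}=\langle b,c\,:\,bc=cb\rangle$, with the homomorphisms $\varphi_{J_1J_2}:G_{J_1}\to G_{J_2}$ given by $a\mapsto a$, $b\mapsto b$, $c\mapsto c$. Let $\mathcal{G}$ be its colimit group. Then for every $K\subseteq\{1,2,3\}$ the natural homomorphism $\tilde\nu_K:\mathcal{G}|_K\to\mathcal{G}$ is injective.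
   Context: A Corson diagram based on a set $I$ consists of a group $G_J$ for every $J\subseteq I$ with $|J|\le 2$ and an injective homomorphism $\varphi_{J_1J_2}:G_{J_1}\to G_{J_2}$ for every strict inclusion $J_1\subset J_2\subseteq I$ with $|J_2|\le 2$, such that $\varphi_{\emptyset J_3}=\varphi_{J_2J_3}\circ\varphi_{\emptyset J_2}$ whenever $\emptyset\subset J_2\subset J_3$ and $|J_3|=2$. (The data in the claim satisfy these conditions.) The colimit group $\mathcal{G}$ is the quotient of the free product of all the $G_J$ ($J\subseteq I$, $|J|\le 2$) by the relations $g=\varphi_{J_1J_2}(g)$ for all $J_1\subset J_2\subseteq I$ with $|J_2|\le 2$ and all $g\in G_{J_1}$. For $K\subseteq I$, $\mathcal{G}|_K$ denotes here the colimit group of the subdiagram spanned by the groups $G_J$ with $J\subseteq K$ and $|J|\le 2$, i.e. the quotient of the free product of these $G_J$ by the relations $g=\varphi_{J_1J_2}(g)$ for all $J_1\subset J_2\subseteq K$ with $|J_2|\le 2$ and all $g\in G_{J_1}$. The natural homomorphism $\tilde\nu_K:\mathcal{G}|_K\to\mathcal{G}$ is the one given by $g\mapsto g$ on each $G_J$ with $J\subseteq K$, $|J|\le 2$. *)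

(* Defs.v *)
From HB Require Import structures.
From mathcomp Require Import all_boot all_algebra boolp.

Set Implicit Arguments.
Unset Strict Implicit.
Unset Printing Implicit Defensive.

Local Open Scope quotient_scope.
Local Open Scope group_scope.

Notation "{ 'gmorphism' G '->' H }" := (UMagmaMorphism.type G H)
  (at level 0, G at level 98, H at level 99) : type_scope.

Section FreeGroup.
Variable X : choiceType.

(* [(x, false)] stands for the letter x, and [(x, true)] for its inverse. *)
Definition word : Type := seq (X * bool).
HB.instance Definition _ := Choice.on word.

Inductive free_equiv : word -> word -> Prop :=
| Fe_cancel u x e v : free_equiv (u ++ (x, e) :: (x, ~~ e) :: v) (u ++ v)
| Fe_refl u : free_equiv u u
| Fe_sym u v : free_equiv u v -> free_equiv v u
| Fe_trans u v w : free_equiv u v -> free_equiv v w -> free_equiv u w.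

Definition free_rel : rel word := fun u v => `[< free_equiv u v >].

Lemma free_rel_refl : reflexive free_rel.
Proof. by move=> u; apply/asboolP/Fe_refl. Qed.
Lemma free_rel_sym : symmetric free_rel.
Proof. by move=> u v; apply/asboolP/asboolP; apply: Fe_sym. Qed.
Lemma free_rel_trans : transitive free_rel.
Proof. by move=> v u w /asboolP uv /asboolP vw; apply/asboolP/(Fe_trans uv). Qed.

Canonical free_rel_equiv :=
  EquivRel free_rel free_rel_refl free_rel_sym free_rel_trans.

Definition free_group := {eq_quot free_rel}.
HB.instance Definition _ := Choice.on free_group.
HB.instance Definition _ := EqQuotient.on free_group.

Definition fword (u : word) : free_group := \pi_free_group u.

Lemma fwordP u v : fword u = fword v <-> free_equiv u v.
Proof.
by split=> [/eqmodP/asboolP|uv] //; apply/eqmodP/asboolP.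
Qed.

Lemma fword_repr q : fword (repr q) = q.
Proof. exact: reprK. Qed.

Definition word_inv (u : word) : word := [seq (p.1, ~~ p.2) | p <- rev u].

Lemma free_equiv_catl t u v : free_equiv u v -> free_equiv (t ++ u) (t ++ v).
Proof.
elim=> {u v} [u x e v|u|u v _ |u v w _ uv _].
- by rewrite !catA; apply: Fe_cancel.
- exact: Fe_refl.
- exact: Fe_sym.
- exact: Fe_trans.
Qed.

Lemma free_equiv_catr t u v : free_equiv u v -> free_equiv (u ++ t) (v ++ t).
Proof.
elim=> {u v} [u x e v|u|u v _ |u v w _ uv _].
- by rewrite -!catA /=; apply: Fe_cancel.
- exact: Fe_refl.
- exact: Fe_sym.
- exact: Fe_trans.
Qed.

Lemma free_equiv_inv u v :
  free_equiv u v -> free_equiv (word_inv u) (word_inv v).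
Proof.
elim=> {u v} [u x e v|u|u v _ |u v w _ uv _].
- rewrite /word_inv !rev_cat !rev_cons -!cats1 !map_cat /= -!catA /= negbK.
  exact: Fe_cancel.
- exact: Fe_refl.
- exact: Fe_sym.
- exact: Fe_trans.
Qed.

Lemma free_equiv_mulV u : free_equiv (word_inv u ++ u) [::].
Proof.
elim: u => [|[x e] u IHu]; first exact: Fe_refl.
rewrite /word_inv rev_cons -cats1 map_cat -catA /=.
have := Fe_cancel (word_inv u) x (~~ e) u; rewrite negbK => xu.
exact: Fe_trans xu IHu.
Qed.

Definition free_mul (p q : free_group) := fword (repr p ++ repr q).
Definition free_one := fword [::].
Definition free_inv (p : free_group) := fword (word_inv (repr p)).

Lemma free_mulE u v : free_mul (fword u) (fword v) = fword (u ++ v).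
Proof.
apply/fwordP; apply: (@Fe_trans _ (u ++ repr (fword v))).
  by apply/free_equiv_catr/fwordP/fword_repr.
by apply/free_equiv_catl/fwordP/fword_repr.
Qed.

Lemma free_invE u : free_inv (fword u) = fword (word_inv u).
Proof. by apply/fwordP/free_equiv_inv/fwordP/fword_repr. Qed.

Lemma free_mulA : associative free_mul.
Proof.
move=> p q r; rewrite -(fword_repr p) -(fword_repr q) -(fword_repr r).
by rewrite !free_mulE catA.
Qed.
Lemma free_mul1g : left_id free_one free_mul.
Proof. by move=> p; rewrite -(fword_repr p) free_mulE. Qed.
Lemma free_mulg1 : right_id free_one free_mul.
Proof. by move=> p; rewrite -(fword_repr p) free_mulE cats0. Qed.
Lemma free_mulVg : left_inverse free_one free_inv free_mul.
Proof.
move=> p; rewrite -(fword_repr p) free_invE free_mulE.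
exact/fwordP/free_equiv_mulV.
Qed.
Lemma free_mulgV : right_inverse free_one free_inv free_mul.
Proof.
move=> p; rewrite -[p in LHS]fword_repr free_invE free_mulE.
have {1}-> : repr p = word_inv (word_inv (repr p)).
  rewrite /word_inv -map_rev revK -map_comp -[LHS]map_id.
  by apply: eq_map => -[x e] /=; rewrite negbK.
exact/fwordP/free_equiv_mulV.
Qed.

HB.instance Definition _ := isGroup.Build free_group
  free_mulA free_mul1g free_mulg1 free_mulVg free_mulgV.

Definition fgen (x : X) : free_group := fword [:: (x, false)].

Lemma fwordM u v : fword (u ++ v) = fword u * fword v.
Proof. by rewrite -free_mulE. Qed.

Lemma fgenV x : (fgen x)^-1 = fword [:: (x, true)].
Proof. exact: free_invE. Qed.

Lemma free_group_ind (P : free_group -> Prop) :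
  P 1 -> (forall x q, P q -> P (fgen x * q)) ->
  (forall x q, P q -> P ((fgen x)^-1 * q)) -> forall q, P q.
Proof.
move=> P1 Pg Pv q; rewrite -(fword_repr q).
elim: (repr q) => [//|[x []] u IHu]; rewrite -cat1s fwordM.
- by rewrite -fgenV; apply: Pv.
- exact: Pg.
Qed.

End FreeGroup.

Section FreeLift.
Variables (X : choiceType) (H : groupType) (f : X -> H).

Definition eval_letter (p : X * bool) : H := if p.2 then (f p.1)^-1 else f p.1.
Definition eval_word (u : word X) : H := \prod_(p <- u) eval_letter p.

Lemma eval_word_equiv u v : free_equiv u v -> eval_word u = eval_word v.
Proof.
elim=> {u v} [u x e v|u|u v _ |u v w _ -> _] //.
rewrite /eval_word !big_cat /= !big_cons; congr (_ * _).
by case: e; rewrite mulgA /eval_letter /= ?mulVg ?mulgV mul1g.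
Qed.

Definition free_lift (q : free_group X) : H := eval_word (repr q).

Lemma free_liftE u : free_lift (fword u) = eval_word u.
Proof. by apply/eval_word_equiv/fwordP/fword_repr. Qed.

Fact free_lift_morph : monoid_morphism free_lift.
Proof.
split; first by rewrite [1]/(fword [::]) free_liftE /eval_word big_nil.
move=> p q; rewrite -(fword_repr p) -(fword_repr q) -fwordM !free_liftE.
by rewrite /eval_word big_cat.
Qed.
HB.instance Definition _ :=
  isUMagmaMorphism.Build (free_group X) H free_lift free_lift_morph.

Lemma free_lift_gen x : free_lift (fgen x) = f x.
Proof. by rewrite free_liftE /eval_word big_seq1. Qed.

End FreeLift.

Lemma free_hom_ext (X : choiceType) (H : groupType)
    (f g : {gmorphism free_group X -> H}) :
  (forall x, f (fgen x) = g (fgen x)) -> f =1 g.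
Proof.
move=> fg; elim/free_group_ind => [|x q IHq|x q IHq].
- by rewrite !gmulf1.
- by rewrite !gmulfM fg IHq.
- by rewrite !gmulfM !gmulfV fg IHq.
Qed.

Section QuotientGroup.
Variables (G : groupType) (R : G -> G -> Prop).

(* The smallest group congruence containing R, i.e. congruence modulo the
   normal closure of the elements x * y^-1 with R x y. *)
Inductive congruence : G -> G -> Prop :=
| Cg_rel x y : R x y -> congruence x y
| Cg_refl x : congruence x x
| Cg_sym x y : congruence x y -> congruence y x
| Cg_trans x y z : congruence x y -> congruence y z -> congruence x z
| Cg_mul x1 y1 x2 y2 :
    congruence x1 y1 -> congruence x2 y2 -> congruence (x1 * x2) (y1 * y2).

Definition quot_rel : rel G := fun x y => `[< congruence x y >].

Lemma quot_rel_refl : reflexive quot_rel.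
Proof. by move=> x; apply/asboolP/Cg_refl. Qed.
Lemma quot_rel_sym : symmetric quot_rel.
Proof. by move=> x y; apply/asboolP/asboolP; apply: Cg_sym. Qed.
Lemma quot_rel_trans : transitive quot_rel.
Proof. by move=> y x z /asboolP xy /asboolP yz; apply/asboolP/(Cg_trans xy). Qed.

Canonical quot_rel_equiv :=
  EquivRel quot_rel quot_rel_refl quot_rel_sym quot_rel_trans.

Definition quot_group := {eq_quot quot_rel}.
HB.instance Definition _ := Choice.on quot_group.
HB.instance Definition _ := EqQuotient.on quot_group.

Definition qclass (x : G) : quot_group := \pi_quot_group x.

Lemma qclassP x y : qclass x = qclass y <-> congruence x y.
Proof. by split=> [/eqmodP/asboolP|xy] //; apply/eqmodP/asboolP. Qed.

Lemma qclass_repr q : qclass (repr q) = q.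
Proof. exact: reprK. Qed.

Definition quot_mul (p q : quot_group) := qclass (repr p * repr q).
Definition quot_one := qclass 1.
Definition quot_inv (p : quot_group) := qclass (repr p)^-1.

Lemma congruenceV x y : congruence x y -> congruence x^-1 y^-1.
Proof.
move=> xy; have yx := Cg_sym xy.
have := Cg_mul (Cg_mul (Cg_refl x^-1) yx) (Cg_refl y^-1).
by rewrite mulVg mul1g -mulgA mulgV mulg1.
Qed.

Lemma quot_mulE x y : quot_mul (qclass x) (qclass y) = qclass (x * y).
Proof. by apply/qclassP/Cg_mul; apply/qclassP/qclass_repr. Qed.

Lemma quot_invE x : quot_inv (qclass x) = qclass x^-1.
Proof. by apply/qclassP/congruenceV/qclassP/qclass_repr. Qed.

Lemma quot_mulA : associative quot_mul.
Proof.
move=> p q r; rewrite -(qclass_repr p) -(qclass_repr q) -(qclass_repr r).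
by rewrite !quot_mulE mulgA.
Qed.
Lemma quot_mul1g : left_id quot_one quot_mul.
Proof. by move=> p; rewrite -(qclass_repr p) quot_mulE mul1g. Qed.
Lemma quot_mulg1 : right_id quot_one quot_mul.
Proof. by move=> p; rewrite -(qclass_repr p) quot_mulE mulg1. Qed.
Lemma quot_mulVg : left_inverse quot_one quot_inv quot_mul.
Proof. by move=> p; rewrite -(qclass_repr p) quot_invE quot_mulE mulVg. Qed.
Lemma quot_mulgV : right_inverse quot_one quot_inv quot_mul.
Proof. by move=> p; rewrite -(qclass_repr p) quot_invE quot_mulE mulgV. Qed.

HB.instance Definition _ := isGroup.Build quot_group
  quot_mulA quot_mul1g quot_mulg1 quot_mulVg quot_mulgV.

Fact qclass_morph : monoid_morphism qclass.
Proof. by split=> // x y; rewrite -quot_mulE. Qed.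
HB.instance Definition _ :=
  isUMagmaMorphism.Build G quot_group qclass qclass_morph.

Lemma qclass_rel x y : R x y -> qclass x = qclass y.
Proof. by move=> Rxy; apply/qclassP/Cg_rel. Qed.

End QuotientGroup.

Section QuotLift.
Variables (G : groupType) (R : G -> G -> Prop) (H : groupType).
Variables (f : {gmorphism G -> H}) (fR : forall x y, R x y -> f x = f y).

Lemma congruence_hom x y : congruence R x y -> f x = f y.
Proof.
elim=> {x y} [x y /fR //|//|//|x y z _ -> _ //|x1 y1 x2 y2 _ e1 _ e2].
by rewrite !gmulfM e1 e2.
Qed.

(* [fR] is kept as an argument, as it is what makes [quot_lift] a morphism. *)
Definition quot_lift of (forall x y, R x y -> f x = f y) :=
  fun q : quot_group R => f (repr q).

Lemma quot_liftE x : quot_lift fR (qclass R x) = f x.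
Proof. by apply/congruence_hom/qclassP/qclass_repr. Qed.

Fact quot_lift_morph : monoid_morphism (quot_lift fR).
Proof.
split; first by rewrite -(gmulf1 (s := qclass R)) quot_liftE gmulf1.
move=> p q; rewrite -(qclass_repr p) -(qclass_repr q) -gmulfM !quot_liftE.
exact: gmulfM.
Qed.
HB.instance Definition _ :=
  isUMagmaMorphism.Build (quot_group R) H (quot_lift fR) quot_lift_morph.

End QuotLift.

Lemma quot_hom_ext (G H : groupType) (R : G -> G -> Prop)
    (f g : {gmorphism quot_group R -> H}) :
  (forall x, f (qclass R x) = g (qclass R x)) -> f =1 g.
Proof. by move=> fg q; rewrite -(qclass_repr q). Qed.

Section FreeProduct.
Variables (T : choiceType) (F : T -> groupType).

Inductive fprod_rel :
  free_group {t : T & F t} -> free_group {t : T & F t} -> Prop :=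
| Fp_mul t (x y : F t) :
    fprod_rel (fgen (Tagged F x) * fgen (Tagged F y)) (fgen (Tagged F (x * y))).

Definition free_product : groupType := quot_group fprod_rel.

Definition fp_in t (x : F t) : free_product :=
  qclass fprod_rel (fgen (Tagged F x)).

Fact fp_in_morph t : monoid_morphism (@fp_in t).
Proof.
have M : {morph (@fp_in t) : x y / x * y}.
  by move=> x y; rewrite /fp_in -gmulfM; apply/esym/qclass_rel/Fp_mul.
split=> //; apply: (mulgI (@fp_in t 1)).
by rewrite -[LHS]M !mulg1.
Qed.
HB.instance Definition _ t :=
  isUMagmaMorphism.Build (F t) free_product (@fp_in t) (fp_in_morph t).
Definition fp_in_hom t : {gmorphism F t -> free_product} := @fp_in t.

Section Lift.
Variables (H : groupType) (f : forall t, {gmorphism F t -> H}).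

Definition fp_lift_gen (s : {t : T & F t}) : H := f (tag s) (tagged s).

Lemma fp_lift_rel p q :
  fprod_rel p q -> free_lift fp_lift_gen p = free_lift fp_lift_gen q.
Proof.
by case=> t x y; rewrite gmulfM /= !free_lift_gen /fp_lift_gen /= gmulfM.
Qed.

Definition fp_lift : {gmorphism free_product -> H} := quot_lift fp_lift_rel.

Lemma fp_liftE t (x : F t) : fp_lift (fp_in x) = f t x.
Proof. exact: etrans (quot_liftE _ _) (free_lift_gen _ _). Qed.

End Lift.

Lemma fp_hom_ext (H : groupType) (f g : {gmorphism free_product -> H}) :
  (forall t (x : F t), f (fp_in x) = g (fp_in x)) -> f =1 g.
Proof.
move=> fg; apply: quot_hom_ext => q.
by apply: (free_hom_ext (f := f \o qclass _) (g := g \o qclass _)) => -[t x];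
   apply: fg.
Qed.

End FreeProduct.

(* Index sets I are taken finite, so that subsets are [{set I}]. *)
Record small_set (I : finType) :=
  SmallSet { sset :> {set I}; sset_le2 : #|sset| <= 2 }.
HB.instance Definition _ (I : finType) := [isSub for @sset I].
HB.instance Definition _ (I : finType) := [Finite of small_set I by <:].

Record corson_diagram (I : finType) := CorsonDiagram {
  cd_grp :> small_set I -> groupType;
  cd_map : forall J1 J2 : small_set I, J1 \proper J2 ->
    {gmorphism cd_grp J1 -> cd_grp J2};
  cd_map_inj : forall (J1 J2 : small_set I) (s12 : J1 \proper J2),
    injective (cd_map s12);
  cd_map_comp : forall (J1 J2 J3 : small_set I) (s12 : J1 \proper J2)
      (s23 : J2 \proper J3) (s13 : J1 \proper J3),
    J1 = set0 :> {set I} -> #|J3| = 2 ->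
    cd_map s13 =1 cd_map s23 \o cd_map s12
}.

Arguments cd_map {I} c {J1 J2} s12.

Section Colimit.
Variables (I : finType) (D : corson_diagram I).

Definition small_sub (K : {set I}) := {J : small_set I | J \subset K}.

Definition sub_free_product (K : {set I}) : groupType :=
  free_product (fun J : small_sub K => D (val J)).

Definition sub_in (K : {set I}) (J : small_sub K) :
    {gmorphism D (val J) -> sub_free_product K} :=
  fp_in_hom (fun J : small_sub K => D (val J)) J.

Inductive colimit_rel (K : {set I}) :
  sub_free_product K -> sub_free_product K -> Prop :=
| Colim_rel (J1 J2 : small_sub K)
    (s12 : val J1 \proper val J2) (g : D (val J1)) :
    colimit_rel (sub_in J1 g) (sub_in J2 (cd_map D s12 g)).

Definition sub_colimit (K : {set I}) : groupType := quot_group (@colimit_rel K).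

Definition colimit : groupType := sub_colimit [set: I].

Definition colim_in (K : {set I}) (J : small_sub K) :
    {gmorphism D (val J) -> sub_colimit K} :=
  qclass (@colimit_rel K) \o sub_in J.

Lemma colim_in_map K (J1 J2 : small_sub K)
    (s12 : val J1 \proper val J2) (g : D (val J1)) :
  colim_in J1 g = colim_in J2 (cd_map D s12 g).
Proof. exact/qclass_rel/Colim_rel. Qed.

Lemma colim_hom_ext K (H : groupType) (f g : {gmorphism sub_colimit K -> H}) :
  (forall J (x : D (val J)), f (colim_in J x) = g (colim_in J x)) -> f =1 g.
Proof.
move=> fg; apply: quot_hom_ext => q.
by apply: (fp_hom_ext (f := f \o qclass _) (g := g \o qclass _)).
Qed.

Section Lift.
Variables (K : {set I}) (H : groupType).
Variable f : forall J : small_sub K, {gmorphism D (val J) -> H}.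
Hypothesis f_map : forall (J1 J2 : small_sub K)
  (s12 : val J1 \proper val J2) (g : D (val J1)),
  f J1 g = f J2 (cd_map D s12 g).

Lemma colim_lift_rel p q :
  colimit_rel p q -> fp_lift f p = fp_lift f q.
Proof. by case=> J1 J2 s12 g; rewrite /sub_in !fp_liftE. Qed.

Definition colim_lift : {gmorphism sub_colimit K -> H} :=
  quot_lift colim_lift_rel.

Lemma colim_liftE J (x : D (val J)) : colim_lift (colim_in J x) = f J x.
Proof. exact: etrans (quot_liftE _ _) (fp_liftE _ _). Qed.

End Lift.

Definition widen_small (K : {set I}) (J : small_sub K) : small_sub [set: I] :=
  exist _ (val J) (subsetT (val J)).

Definition nat_hom (K : {set I}) : {gmorphism sub_colimit K -> colimit} :=
  colim_lift (f := fun J : small_sub K => colim_in (widen_small J))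
    (fun J1 J2 s12 g =>
       colim_in_map (J1 := widen_small J1) (J2 := widen_small J2) s12 g).

Lemma nat_homE K (J : small_sub K) (x : D (val J)) :
  nat_hom K (colim_in J x) = colim_in (widen_small J) x.
Proof. exact: colim_liftE. Qed.

End Colimit.

Definition presented (X : choiceType)
    (R : free_group X -> free_group X -> Prop) : groupType := quot_group R.

Definition pgen (X : choiceType) (R : free_group X -> free_group X -> Prop)
  (x : X) : presented R := qclass R (fgen x).

Section PresentedLift.
Variables (X : choiceType) (R : free_group X -> free_group X -> Prop).
Variables (H : groupType) (f : X -> H).
Hypothesis fR : forall p q, R p q -> free_lift f p = free_lift f q.

Definition pres_lift : {gmorphism presented R -> H} := quot_lift fR.

Lemma pres_lift_gen x : pres_lift (pgen R x) = f x.
Proof. exact: etrans (quot_liftE _ _) (free_lift_gen _ _). Qed.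

End PresentedLift.

Lemma pres_hom_ext (X : choiceType) (R : free_group X -> free_group X -> Prop)
    (H : groupType) (f g : {gmorphism presented R -> H}) :
  (forall x, f (pgen R x) = g (pgen R x)) -> f =1 g.
Proof.
move=> fg; apply: quot_hom_ext => q.
by apply: (free_hom_ext (f := f \o qclass _) (g := g \o qclass _)).
Qed.

(* The labels 1, 2, 3 are 0, 1, 2 in ['I_3]; the generator with label i of a
   vertex group is called a, b, c for i = 1, 2, 3. *)
Definition lab1 : 'I_3 := @Ordinal 3 0 isT.
Definition lab2 : 'I_3 := @Ordinal 3 1 isT.
Definition lab3 : 'I_3 := @Ordinal 3 2 isT.

Section TriangleGroup.
Variable J : {set 'I_3}.

Definition tri_gens := {i : 'I_3 | i \in J}.

Definition tri_letter (i : 'I_3) (iJ : i \in J) : free_group tri_gens :=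
  fgen (exist (fun i => i \in J) i iJ).

(* The relations whose two letters both have their label in J: for #|J| <= 2
   there is exactly one if #|J| = 2, and none if #|J| <= 1. *)
Inductive tri_rel : free_group tri_gens -> free_group tri_gens -> Prop :=
| Tri_ab (J1 : lab1 \in J) (J2 : lab2 \in J) :
    let a := tri_letter J1 in let b := tri_letter J2 in
    tri_rel (b^-1 * a * b) (a ^+ 2)
| Tri_ac (J1 : lab1 \in J) (J3 : lab3 \in J) :
    let a := tri_letter J1 in let c := tri_letter J3 in
    tri_rel (c^-1 * a * c) (a ^+ 2)
| Tri_bc (J2 : lab2 \in J) (J3 : lab3 \in J) :
    let b := tri_letter J2 in let c := tri_letter J3 in
    tri_rel (b * c) (c * b).

Definition tri_grp : groupType := presented tri_rel.

Definition tri_gen (i : 'I_3) (iJ : i \in J) : tri_grp :=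
  qclass tri_rel (tri_letter iJ).

End TriangleGroup.

Section TriangleLift.
Variables (J : {set 'I_3}) (H : groupType).
Variable f : forall i : 'I_3, i \in J -> H.
Hypothesis f_ab : forall (J1 : lab1 \in J) (J2 : lab2 \in J),
  (f J2)^-1 * f J1 * f J2 = f J1 ^+ 2.
Hypothesis f_ac : forall (J1 : lab1 \in J) (J3 : lab3 \in J),
  (f J3)^-1 * f J1 * f J3 = f J1 ^+ 2.
Hypothesis f_bc : forall (J2 : lab2 \in J) (J3 : lab3 \in J),
  f J2 * f J3 = f J3 * f J2.

Definition tri_lift_gen (x : tri_gens J) : H := f (valP x).

Lemma tri_lift_letter i (iJ : i \in J) :
  free_lift tri_lift_gen (tri_letter iJ) = f iJ.
Proof. by rewrite free_lift_gen /tri_lift_gen; congr f; apply: bool_irrelevance. Qed.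

Lemma tri_lift_rel p q :
  tri_rel p q -> free_lift tri_lift_gen p = free_lift tri_lift_gen q.
Proof.
case=> [J1 J2 a b|J1 J3 a c|J2 J3 b c]; rewrite ?gmulfXn !gmulfM ?gmulfV /=.
- by rewrite !tri_lift_letter f_ab.
- by rewrite !tri_lift_letter f_ac.
- by rewrite !tri_lift_letter f_bc.
Qed.

Definition tri_lift : {gmorphism tri_grp J -> H} := pres_lift tri_lift_rel.

Lemma tri_lift_genE i (iJ : i \in J) : tri_lift (tri_gen iJ) = f iJ.
Proof. exact: etrans (quot_liftE _ _) (tri_lift_letter iJ). Qed.

End TriangleLift.

Lemma tri_hom_ext (J : {set 'I_3}) (H : groupType)
    (f g : {gmorphism tri_grp J -> H}) :
  (forall i (iJ : i \in J), f (tri_gen iJ) = g (tri_gen iJ)) -> f =1 g.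
Proof. by move=> fg; apply: pres_hom_ext => -[i iJ]; apply: fg. Qed.

Section TriangleMap.
Variables (J : {set 'I_3}).

Lemma tri_gen_ab (J1 : lab1 \in J) (J2 : lab2 \in J) :
  (tri_gen J2)^-1 * tri_gen J1 * tri_gen J2 = tri_gen J1 ^+ 2.
Proof.
have := qclass_rel (Tri_ab J1 J2); rewrite !gmulfM gmulfV; exact.
Qed.

Lemma tri_gen_ac (J1 : lab1 \in J) (J3 : lab3 \in J) :
  (tri_gen J3)^-1 * tri_gen J1 * tri_gen J3 = tri_gen J1 ^+ 2.
Proof.
have := qclass_rel (Tri_ac J1 J3); rewrite !gmulfM gmulfV; exact.
Qed.

Lemma tri_gen_bc (J2 : lab2 \in J) (J3 : lab3 \in J) :
  tri_gen J2 * tri_gen J3 = tri_gen J3 * tri_gen J2.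
Proof. by have := qclass_rel (Tri_bc J2 J3); rewrite !gmulfM. Qed.

End TriangleMap.

Section TriangleDiagram.
Variables (J1 J2 : {set 'I_3}) (s12 : J1 \proper J2).

Let sub12 i (iJ : i \in J1) : i \in J2 := subsetP (proper_sub s12) i iJ.

Definition tri_map : {gmorphism tri_grp J1 -> tri_grp J2} :=
  tri_lift (f := fun i (iJ : i \in J1) => tri_gen (sub12 iJ))
    (fun i j => tri_gen_ab (sub12 i) (sub12 j))
    (fun i j => tri_gen_ac (sub12 i) (sub12 j))
    (fun i j => tri_gen_bc (sub12 i) (sub12 j)).

Lemma tri_map_gen i (i1 : i \in J1) (i2 : i \in J2) :
  tri_map (tri_gen i1) = tri_gen i2.
Proof.
rewrite /tri_map tri_lift_genE; congr tri_gen; exact: bool_irrelevance.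
Qed.

End TriangleDiagram.

Lemma tri_map_comp (J1 J2 J3 : {set 'I_3}) (s12 : J1 \proper J2)
    (s23 : J2 \proper J3) (s13 : J1 \proper J3) :
  tri_map s13 =1 tri_map s23 \o tri_map s12.
Proof.
apply: tri_hom_ext => i i1.
have i2 := subsetP (proper_sub s12) i i1; have i3 := subsetP (proper_sub s23) i i2.
rewrite (tri_map_gen s13 i1 i3) -(tri_map_gen s23 i2 i3).
by rewrite -(tri_map_gen s12 i1 i2).
Qed.

(* The semidirect product of int and rat, where 1 in int acts on rat by
   doubling; it is used only to show that the [tri_map]s are injective. *)
Definition affine : Type := (int * rat)%type.
HB.instance Definition _ := Choice.on affine.

Section Affine.
Local Open Scope ring_scope.
Import GRing.Theory Num.Theory.

Definition aff_mul (p q : affine) : affine :=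
  (p.1 + q.1, p.2 * 2%:R ^ q.1 + q.2).
Definition aff_one : affine := (0, 0).
Definition aff_inv (p : affine) : affine := (- p.1, - (p.2 * 2%:R ^ (- p.1))).

Lemma aff_mulA : associative aff_mul.
Proof.
move=> [k s] [l t] [m u]; rewrite /aff_mul /= addrA.
by rewrite expfzDr // mulrDl mulrA addrA.
Qed.
Lemma aff_mul1g : left_id aff_one aff_mul.
Proof. by move=> [k s]; rewrite /aff_mul /= mul0r !add0r. Qed.
Lemma aff_mulg1 : right_id aff_one aff_mul.
Proof. by move=> [k s]; rewrite /aff_mul /= expr0z mulr1 !addr0. Qed.
Lemma aff_mulVg : left_inverse aff_one aff_inv aff_mul.
Proof.
move=> [k s]; rewrite /aff_mul /= addNr mulNr -mulrA -expfzDr // addNr.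
by rewrite expr0z mulr1 addNr.
Qed.
Lemma aff_mulgV : right_inverse aff_one aff_inv aff_mul.
Proof. by move=> [k s]; rewrite /aff_mul /= !addrN. Qed.

HB.instance Definition _ := isGroup.Build affine
  aff_mulA aff_mul1g aff_mulg1 aff_mulVg aff_mulgV.

Lemma affE (p q : affine) :
  (p * q)%g = (p.1 + q.1, p.2 * 2%:R ^ q.1 + q.2) :> affine.
Proof. by []. Qed.

Definition aff_letter (i : 'I_3) : affine :=
  if i == lab1 then (0, 1) else (1, 0).

Lemma aff_letterX i n :
  (aff_letter i ^+ n)%g =
    if i == lab1 then (0, n%:R) else (n%:R, 0) :> affine.
Proof.
rewrite /aff_letter; elim: n => [|n IHn]; first by case: ifP.
rewrite expgSr IHn; case: ifP => _; rewrite affE /=.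
- by rewrite expr0z mulr1 addr0 natr1.
- by rewrite mul0r addr0 natr1.
Qed.

Lemma aff_letterX_inj i m n :
  (aff_letter i ^+ m = aff_letter i ^+ n)%g -> m = n.
Proof.
rewrite !aff_letterX; case: ifP => _ [] /eqP.
- by rewrite eqr_nat => /eqP.
- by rewrite eqr_nat => /eqP.
Qed.

Lemma aff_letter_conj i : i != lab1 ->
  ((aff_letter i)^-1 * aff_letter lab1 * aff_letter i = aff_letter lab1 ^+ 2)%g.
Proof.
move=> i1; rewrite -mulgA; apply/(mulgI (aff_letter i)); rewrite mulVKg.
by rewrite aff_letterX /aff_letter (negbTE i1) /= !affE /=.
Qed.
End Affine.

Definition tri_aff (J : {set 'I_3}) : {gmorphism tri_grp J -> affine} :=
  tri_lift (f := fun i (iJ : i \in J) => aff_letter i)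
    (fun _ _ => aff_letter_conj (i := lab2) isT)
    (fun _ _ => aff_letter_conj (i := lab3) isT) (fun _ _ => erefl).

Lemma tri_aff_gen (J : {set 'I_3}) i (iJ : i \in J) :
  tri_aff J (tri_gen iJ) = aff_letter i.
Proof. exact: tri_lift_genE. Qed.

Lemma tri_aff_map (J1 J2 : {set 'I_3}) (s12 : J1 \proper J2) :
  tri_aff J2 \o tri_map s12 =1 tri_aff J1.
Proof.
apply: tri_hom_ext => i i1; have i2 := subsetP (proper_sub s12) i i1.
rewrite tri_aff_gen -(tri_aff_gen i2).
by rewrite -(tri_map_gen s12 i1 i2).
Qed.

Lemma tri_grp_ind (J : {set 'I_3}) (P : tri_grp J -> Prop) :
  P 1 -> (forall i (iJ : i \in J) q, P q -> P (tri_gen iJ * q)) ->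
  (forall i (iJ : i \in J) q, P q -> P ((tri_gen iJ)^-1 * q)) ->
  forall q, P q.
Proof.
move=> P1 Pg Pv q; rewrite -(qclass_repr q).
elim/free_group_ind: (repr q) => [|[i iJ] u IHu|[i iJ] u IHu].
- by rewrite gmulf1.
- by rewrite gmulfM; apply: Pg.
- by rewrite gmulfM gmulfV; apply: Pv.
Qed.

Lemma tri_grp_cyclic (J : {set 'I_3}) i (iJ : i \in J) (q : tri_grp J) :
  #|J| <= 1 -> exists m n, q = tri_gen iJ ^+ m / tri_gen iJ ^+ n.
Proof.
move=> /card_le1_eqP J1; have gE j (jJ : j \in J) : tri_gen jJ = tri_gen iJ.
  have ji := J1 _ _ jJ iJ; subst j.
  by congr tri_gen; apply: bool_irrelevance.
elim/tri_grp_ind: q => [|j jJ q [m [n ->]]|j jJ q [m [n ->]]].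
- by exists 0, 0; rewrite divgg.
- by exists m.+1, n; rewrite gE mulgA -expgS.
- exists m, n.+1; rewrite gE mulgA expgSr invgM mulgA.
  congr (_ / _); apply: (mulgI (tri_gen iJ)); rewrite mulVKg mulgA.
  by rewrite -expgS expgSr mulgK.
Qed.

Lemma tri_map_inj (J1 J2 : {set 'I_3}) (s12 : J1 \proper J2) :
  #|J2| <= 2 -> injective (tri_map s12).
Proof.
move=> J2_le2; have J1_le1 : #|J1| <= 1.
  by rewrite -ltnS (leq_trans (proper_card s12)).
apply: gmulf_inj => q q1.
have : tri_aff J1 q = 1 by rewrite -(tri_aff_map s12) /comp q1 gmulf1.
have [J10|[i iJ]] := set_0Vmem J1.
  have J1F i : i \in J1 -> False by rewrite J10 inE.
  by elim/tri_grp_ind: q {q1} => // i iJ; case: (J1F i iJ).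
have [m [n ->]] := tri_grp_cyclic iJ q J1_le1.
rewrite gmulfF !gmulfXn tri_aff_gen => /divg1_eq/aff_letterX_inj ->.
exact: divgg.
Qed.

Definition triangle : corson_diagram 'I_3 :=
  @CorsonDiagram 'I_3 (fun J => tri_grp J) (fun J1 J2 s12 => tri_map s12)
    (fun J1 J2 s12 => tri_map_inj (sset_le2 J2))
    (fun J1 J2 J3 s12 s23 s13 _ _ => tri_map_comp s12 s23 s13).

Arguments quot_lift : simpl never.
Arguments fp_lift : simpl never.
Arguments colim_lift : simpl never.
Arguments colim_in : simpl never.
Arguments sub_in : simpl never.
Arguments nat_hom : simpl never.
Arguments pres_lift : simpl never.
Arguments tri_lift : simpl never.
Arguments tri_map : simpl never.

(* Main.v *)
Require Import Defs.
From HB Require Import structures.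
From mathcomp Require Import all_boot.

Set Implicit Arguments.
Unset Strict Implicit.
Unset Printing Implicit Defensive.

(** Write G for the colimit group.  It maps onto each of the three edge groups
    in a way that restricts to the identity on that edge group:
    - onto <b, c> by sending a to 1;
    - onto <a, b> by sending c to b;
    - onto <a, c> by sending b to c.
    The relations of G survive.  In the first case b^-1 a b = a^2 and
    c^-1 a c = a^2 become 1 = 1, and bc = cb is kept.  In the other two, both
    conjugation relations become the one relation of the edge group, and bc = cb
    becomes trivial ([edge_retraction]).

    Let K be a proper subset of the labels, so that K lies in the edge E
    consisting of the labels other than some i.  The diagram spanned by the
    subsets of K has K as its last object, so G_K maps onto its colimit
    ([colim_in_surj]).  Composing G_K -> G|_K -> G with the retraction of G onto
    G_E gives the map G_K -> G_E of the diagram, or the identity if K = E, which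
    is injective; since G_K -> G|_K is onto, G|_K -> G is injective.  If K
    contains all labels, then G|_K -> G is the identity. *)

Local Open Scope group_scope.

Lemma free_hom_in_image (X : choiceType) (G H : groupType)
    (f : {gmorphism free_group X -> H}) (g : {gmorphism G -> H}) :
  (forall x, exists y, f (fgen x) = g y) -> forall p, exists y, f p = g y.
Proof.
move=> fg; elim/free_group_ind => [|x p [y fp]|x p [y fp]].
- by exists 1; rewrite !gmulf1.
- by have [z fz] := fg x; exists (z * y); rewrite !gmulfM fp fz.
- by have [z fz] := fg x; exists (z^-1 * y); rewrite !gmulfM !gmulfV fp fz.
Qed.

(** If [K] itself indexes a group, then each group of the subdiagram maps to the
    one at [K], so its elements are already elements of the latter in the
    colimit; and these groups generate the colimit. *)
Lemma colim_in_surj (I : finType) (D : corson_diagram I) (K : {set I})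
    (J0 : small_sub K) :
  val J0 = K :> {set I} ->
  forall q : sub_colimit D K, exists x, q = colim_in D J0 x.
Proof.
move=> J0K; have inJ0 (J : small_sub K) (x : D (val J)) :
    exists y, colim_in D J x = colim_in D J0 y.
  have JsJ0 : val J \subset val J0 by rewrite J0K; apply: (valP J).
  have [JJ0|JJ0] := eqVproper JsJ0.
  - have JE : J = J0 by apply/val_inj/val_inj.
    by subst J; exists x.
  - by exists (cd_map D JJ0 x); apply: colim_in_map.
move=> q; rewrite -(qclass_repr q) -(qclass_repr (repr q)).
pose pi : {gmorphism free_group _ -> sub_colimit D K} := qclass _ \o qclass _.
by apply: (free_hom_in_image (f := pi)) => -[J x]; apply: inJ0.
Qed.

(** A map out of all groups of the triangle at once is given by values on all
    three labels; hence the default [d], for the label missing from an edge. *)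
Definition gen_or (J : {set 'I_3}) (d : tri_grp J) (j : 'I_3) : tri_grp J :=
  if @idP (j \in J) is ReflectT jJ then tri_gen jJ else d.

Lemma gen_or_in (J : {set 'I_3}) (d : tri_grp J) j (jJ : j \in J) :
  gen_or d j = tri_gen jJ.
Proof.
rewrite /gen_or; case: {-}_ / idP => [jJ'|/(_ jJ) //].
by congr tri_gen; apply: bool_irrelevance.
Qed.

Lemma gen_or_out (J : {set 'I_3}) (d : tri_grp J) j :
  j \notin J -> gen_or d j = d.
Proof. by rewrite /gen_or => jJ; case: {-}_ / idP => // jJ'; rewrite jJ' in jJ. Qed.

(** The maps that the universal property of the colimit requires on all groups of
    the triangle come from a single assignment of values to a, b and c. *)
Lemma triangle_lift (H : groupType) (h : 'I_3 -> H) :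
  (h lab2)^-1 * h lab1 * h lab2 = h lab1 ^+ 2 ->
  (h lab3)^-1 * h lab1 * h lab3 = h lab1 ^+ 2 ->
  h lab2 * h lab3 = h lab3 * h lab2 ->
  exists F : {gmorphism colimit triangle -> H},
    forall (J : small_sub [set: 'I_3]) j (jJ : j \in val J),
      F (colim_in triangle J (tri_gen jJ)) = h j.
Proof.
move=> h12 h13 h23.
pose f (J : {set 'I_3}) := tri_lift (J := J) (f := fun i _ => h i)
  (fun _ _ => h12) (fun _ _ => h13) (fun _ _ => h23).
have f_map (J1 J2 : small_sub [set: 'I_3]) (s12 : val J1 \proper val J2) :
    f (val J1) =1 f (val J2) \o tri_map s12.
  apply: tri_hom_ext => i i1.
  have i2 := subsetP (proper_sub s12) i i1.
  by rewrite /= (tri_map_gen s12 i1 i2) !tri_lift_genE.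
exists (colim_lift (D := triangle) (f := fun J => f (val J)) f_map) => J j jJ.
by rewrite colim_liftE tri_lift_genE.
Qed.

(** The generator with label [i] has to go to some element of the edge group
    opposite to [i]: 1 works for a, and c and b can replace each other, as they
    act on a by conjugation in the same way and commute with themselves. *)
Lemma edge_retraction (i : 'I_3) :
  exists F : {gmorphism colimit triangle -> tri_grp [set~ i]},
    forall (J : small_sub [set: 'I_3]) j (jJ : j \in val J) (ji : j \in [set~ i]),
      F (colim_in triangle J (tri_gen jJ)) = tri_gen ji.
Proof.
suff [d [dab dac dbc]] : exists d : tri_grp [set~ i], let h := gen_or d in
    [/\ (h lab2)^-1 * h lab1 * h lab2 = h lab1 ^+ 2,
        (h lab3)^-1 * h lab1 * h lab3 = h lab1 ^+ 2
      & h lab2 * h lab3 = h lab3 * h lab2].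
  have [F FE] := triangle_lift dab dac dbc.
  by exists F => J j jJ ji; rewrite FE (gen_or_in d ji).
have in_edge j : j != i -> j \in [set~ i] by rewrite !inE.
have out_edge : i \notin [set~ i] by rewrite !inE eqxx.
have [i1|[i2|i3]] : i = lab1 \/ i = lab2 \/ i = lab3.
- by case: i {in_edge out_edge} => -[|[|[]]] // ?;
    [left|right; left|right; right]; apply: val_inj.
- subst i; have [J2 J3] := (in_edge lab2 isT, in_edge lab3 isT).
  exists 1; rewrite /= (gen_or_out _ out_edge) (gen_or_in _ J2) (gen_or_in _ J3).
  by rewrite !mulg1 !mulVg expg1n; split=> //; apply: tri_gen_bc.
- subst i; have [J1 J3] := (in_edge lab1 isT, in_edge lab3 isT).
  exists (tri_gen J3).
  rewrite /= (gen_or_out _ out_edge) (gen_or_in _ J1) (gen_or_in _ J3).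
  by split=> //; apply: tri_gen_ac.
- subst i; have [J1 J2] := (in_edge lab1 isT, in_edge lab2 isT).
  exists (tri_gen J2).
  rewrite /= (gen_or_out _ out_edge) (gen_or_in _ J1) (gen_or_in _ J2).
  by split=> //; apply: tri_gen_ab.
Qed.

Lemma nat_hom_setT_id (I : finType) (D : corson_diagram I) :
  nat_hom D [set: I] =1 idfun.
Proof.
apply: (colim_hom_ext (g := idfun)) => -[J sJ] x; rewrite nat_homE.
by rewrite /widen_small (bool_irrelevance (subsetT _) sJ).
Qed.

Theorem proposition3p1 (K : {set 'I_3}) : injective (nat_hom triangle K).
Proof.
have [->|] := eqVneq K [set: 'I_3].
  by move=> p q; rewrite !nat_hom_setT_id.
rewrite -subTset => /subsetPn[i _ iK].
have KE : K \subset [set~ i] by rewrite subsetC sub1set inE.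
have K2 : #|K| <= 2.
  by rewrite (leq_trans (subset_leq_card KE)) // cardsC1 card_ord.
pose J0 : small_sub K := exist _ (SmallSet K2) (subxx K).
have [F FE] := edge_retraction i.
have F_inj : injective (F \o (nat_hom triangle K \o colim_in triangle J0)).
  (* On generators the composite is the inclusion of labels. *)
  have [KEi|KEi] := eqVproper KE.
    subst K; apply: (eq_inj (f := idfun)) => //; apply: fsym.
    apply: (tri_hom_ext (g := idfun)) => j jK.
    by rewrite /= nat_homE (FE _ _ _ jK).
  apply: (eq_inj (tri_map_inj (s12 := KEi) _)); first by rewrite cardsC1 card_ord.
  apply: fsym; apply: tri_hom_ext => j jK.
  rewrite /= nat_homE (FE _ _ _ (subsetP KE j jK)).
  by rewrite (tri_map_gen KEi jK (subsetP KE j jK)).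
move=> p q.
have [x ->] := colim_in_surj (J0 := J0) erefl p.
have [y ->] := colim_in_surj (J0 := J0) erefl q.
by move=> pq; congr (colim_in _ _ _); apply/F_inj/(congr1 F pq).
Qed.
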